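(* Let $d\ge 1$, let $a(x)=\frac{1}{(4\pi)^{d/2}}e^{-x^2/4}$ on $\mathbb{R}^d$ (with $x^2=|x|^2$), and let $v(x,t)=e^{-t}\sum_{k=1}^{\infty}\frac{t^k a^{\ast k}(x)}{k!}$. Then the following asymptotics hold as $t\to\infty$. 1) For any $r>0$, if $|x|\le r t^{1/2}$, then $$v(x,t)=\frac{1}{(4\pi t)^{d/2}}e^{-\frac{x^2}{4t}}\bigl(1+o(t^{-1/4})\bigr).$$ 2) For any $r>0$, if $|x|=r t^{\frac{1+\delta}{2}}$ with $0<\delta<1$, then $$\frac{\ln v(x,t)}{x^2/(4t)}\to -1 .$$ In particular, if $r_1t^{\frac{1+\delta}{2}}\le |x|\le r_2t^{\frac{1+\delta}{2}}$ with some $0<r_1<r_2$ and $0<\delta<1$, then $$e^{-\frac{r_2^2}{4}t^{\delta}(1+o(1))}\le v(x,t)\le e^{-\frac{r_1^2}{4}t^{\delta}(1+o(1))}.$$ 3) For any $r>0$, if $|x|=rt$, then $$\frac{\ln v(x,t)}{t}\to-\Phi_G(r).$$ Furthermore, $0<\Phi_G(r)<r^2/4$ for all $r\neq 0$; $\Phi_G(r)=\frac{r^2}{4}(1+o(1))$ as $r\to0+$; and $\Phi_G(r)=r\sqrt{\ln r}\,(1+o(1))$ as $r\to\infty$. 4) If $|x|>t^{\frac{1+\delta}{2}}$ with $\delta>1$, then $$\frac{\ln v(x,t)}{|x|\sqrt{\ln\frac{|x|}{t}}}\to-1 .$$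
   Context: $a^{\ast k}$ denotes the $k$-fold convolution power of $a$ on $\mathbb{R}^d$ ($a^{\ast 1}=a$). The function $v$ is the regular part of the fundamental solution of $\partial_t u-(a\ast u-u)=0$. For $r\ne0$, let $\xi_r$ be the (unique positive) solution of the equation $\xi^2\ln\xi=\frac{r^2}{4}$; then $\Phi_G(r)=1+2\xi_r\ln\xi_r-\xi_r$. In each item $x=x(t)\in\mathbb{R}^d$ is any point satisfying the indicated relation to $t$, and $o(\cdot)$ and limits are as $t\to\infty$ with the parameters $r,r_1,r_2,\delta,d$ fixed. *)

(* Defs.v *)
From HB Require Import structures.
From mathcomp Require Import all_boot all_order all_algebra.
From mathcomp Require Import all_classical all_reals all_analysis.

Set Implicit Arguments.
Unset Strict Implicit.
Unset Printing Implicit Defensive.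

Import Order.TTheory GRing.Theory Num.Theory.
Import numFieldTopology.Exports numFieldNormedType.Exports.

Local Open Scope classical_set_scope.
Local Open Scope ring_scope.

(* Points of R^d are d-tuples, which carry the product sigma-algebra; the
   Lebesgue measure on R^d is the d-fold product of lebesgue_measure,
   transported along (y, z) |-> y :: z. *)
Definition tuple_cons (T : Type) (n : nat) (p : T * n.-tuple T) : n.+1.-tuple T :=
  [tuple of p.1 :: p.2].

Section lebesgue_cons.
Context {R : realType} (n : nat).
Variable m : {sigma_finite_measure set (n.-tuple (measurableTypeR R)) -> \bar R}.

Lemma measurable_tuple_cons :
  measurable_fun [set: measurableTypeR R * n.-tuple (measurableTypeR R)]
    (@tuple_cons (measurableTypeR R) n).
Proof. exact: measurable_cons. Qed.

Definition lebesgue_cons : set (n.+1.-tuple (measurableTypeR R)) -> \bar R :=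
  pushforward (@lebesgue_measure R \x m)%E (@tuple_cons (measurableTypeR R) n).

Let lebesgue_cons_additive : semi_sigma_additive lebesgue_cons.
Proof.
rewrite /lebesgue_cons => F mF tF mUF; rewrite /pushforward preimage_bigcup.
have mc A : measurable A ->
    measurable (@tuple_cons (measurableTypeR R) n @^-1` A).
  by move=> mA; rewrite -[X in measurable X]setTI; exact: measurable_tuple_cons.
apply: measure_semi_sigma_additive.
- by move=> k; exact: mc.
- apply/trivIsetP => /= i j _ _ ij; rewrite -preimage_setI.
  by move/trivIsetP : tF => /(_ _ _ _ _ ij) ->//; rewrite preimage_set0.
- by rewrite -preimage_bigcup; exact: mc.
Qed.

Let lebesgue_cons0 : lebesgue_cons set0 = 0%E.
Proof. by rewrite /lebesgue_cons /pushforward preimage_set0 measure0. Qed.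

Let lebesgue_cons_ge0 A : (0 <= lebesgue_cons A)%E.
Proof. by rewrite /lebesgue_cons /pushforward. Qed.

HB.instance Definition _ := isMeasure.Build _ _ _ lebesgue_cons
  lebesgue_cons0 lebesgue_cons_ge0 lebesgue_cons_additive.

Let lebesgue_cons_sigma_finite : sigma_finite setT lebesgue_cons.
Proof.
have /sigma_finiteP[F [TF ndF Foo]] := sigma_finiteT (@lebesgue_measure R).
have /sigma_finiteP[G [TG ndG Goo]] := sigma_finiteT m.
pose g (x : n.+1.-tuple (measurableTypeR R)) :
    measurableTypeR R * n.-tuple (measurableTypeR R) :=
  (thead x, [tuple of behead x]).
have mg : measurable_fun setT g.
  apply: measurable_fun_pair; first exact: measurable_tnth.
  exact: measurable_behead.
exists (fun k => g @^-1` (F k `*` G k)).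
  apply/seteqP; split=> // x _.
  have [i _ Fi] : (\bigcup_i F i) (g x).1 by rewrite -TF.
  have [j _ Gj] : (\bigcup_i G i) (g x).2 by rewrite -TG.
  exists (maxn i j) => //; split.
  - by move: Fi; exact/subsetPset/ndF/leq_maxl.
  - by move: Gj; exact/subsetPset/ndG/leq_maxr.
move=> k; have [mF Fy] := Foo k; have [mG Gy] := Goo k; split.
  by rewrite -[X in measurable X]setTI; apply: mg => //; exact: measurableX.
rewrite /lebesgue_cons /pushforward.
suff -> : @tuple_cons (measurableTypeR R) n @^-1` (g @^-1` (F k `*` G k)) =
    F k `*` G k.
  by rewrite product_measure1E// lte_mul_pinfty// ge0_fin_numE.
rewrite -comp_preimage (_ : g \o _ = id) ?preimage_id//.
apply/funext => -[y z]; rewrite /g /tuple_cons /=; congr pair.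
exact/val_inj.
Qed.

HB.instance Definition _ := Measure_isSigmaFinite.Build _ _ _ lebesgue_cons
  lebesgue_cons_sigma_finite.

End lebesgue_cons.

Fixpoint lebesgue_tuple (R : realType) (d : nat) :
    {sigma_finite_measure set (d.-tuple (measurableTypeR R)) -> \bar R} :=
  match d with
  | 0 => \d_([tuple] : 0.-tuple (measurableTypeR R))
  | n.+1 => lebesgue_cons (lebesgue_tuple R n)
  end.

Lemma lebesgue_tuple_box (R : realType) (d : nat)
    (A : 'I_d -> set (measurableTypeR R)) : (forall i, measurable (A i)) ->
  lebesgue_tuple R d [set x | forall i, A i (tnth x i)] =
  (\prod_(i < d) lebesgue_measure (A i))%E.
Proof.
elim: d A => [|d IH] A mA /=.
  rewrite big_ord0 diracE mem_set//= => -[]//.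
rewrite big_ord_recl -IH//.
rewrite /lebesgue_cons /pushforward.
rewrite (_ : _ @^-1` _ = A ord0 `*`
    [set x : d.-tuple (measurableTypeR R) | forall i, A (lift ord0 i) (tnth x i)]).
  rewrite product_measure1E//.
  rewrite (_ : [set _ | _] = \bigcap_i
      ((@tnth d (measurableTypeR R) ^~ i) @^-1` A (lift ord0 i))); last first.
    by apply/seteqP; split=> [x h i _|x h i]; [exact: h|exact: (h i)].
  apply: fin_bigcap_measurable => // i _.
  by rewrite -[X in measurable X]setTI; exact: measurable_tnth.
apply/seteqP; split => -[y z] /=.
  by move=> h; split=> [|i]; [exact: (h ord0)|have := h (lift ord0 i); rewrite tnthS].
move=> [h0 h] i; case: (unliftP ord0 i) => [j ->|->//].
by rewrite tnthS.
Qed.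

Section heat.
Variables (R : realType) (d : nat).
Implicit Types (x y : d.-tuple R) (f g : d.-tuple R -> R) (t : R).

Definition tuple_sub x y : d.-tuple R := [tuple tnth x i - tnth y i | i < d].

(* the Euclidean norm *)
Definition enorm x : R := Num.sqrt (\sum_(i < d) tnth x i ^+ 2).

Definition conv f g x : R :=
  \int[lebesgue_tuple R d]_y (f (tuple_sub x y) * g y).

(* f^{*k} for k >= 1 (the value at k = 0 is irrelevant) *)
Definition conv_pow f (k : nat) : d.-tuple R -> R := iter k.-1 (conv f) f.

Definition gauss x : R :=
  ((4 * pi) `^ (d%:R / 2))^-1 * expR (- (enorm x ^+ 2 / 4)).

Definition v x t : R :=
  expR (- t) * \big[+%R/0]_(1 <= k <oo) (t ^+ k * conv_pow gauss k x / k`!%:R).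

End heat.

Definition xi (R : realType) (r : R) : R :=
  get [set z : R | 0 < z /\ z ^+ 2 * ln z = r ^+ 2 / 4].

Lemma xi_unique (R : realType) (r z : R) : r != 0 ->
  0 < z -> z ^+ 2 * ln z = r ^+ 2 / 4 -> z = xi r.
Proof.
move=> r0 z0 zr; have c0 : 0 < r ^+ 2 / 4.
  by rewrite divr_gt0// exprn_even_gt0.
have main (a b : R) : 0 < a -> 0 < b -> 0 < a ^+ 2 * ln a ->
    a < b -> a ^+ 2 * ln a < b ^+ 2 * ln b.
  move=> a0 b0; rewrite pmulr_rgt0 ?exprn_gt0// => lna ab.
  by rewrite ltr_pM ?exprn_ge0 ?(ltW a0) ?(ltW lna) ?ltr_ln ?ltrXn2r ?ltW.
rewrite /xi; case: xgetP => [y _ /= [y0 yr]|/(_ z)/= []//].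
case: (ltgtP z y) => // [zy|yz].
- by have := main _ _ z0 y0; rewrite zr yr ltxx => /(_ c0 zy).
- by have := main _ _ y0 z0; rewrite zr yr ltxx => /(_ c0 yz).
Qed.

Lemma xi_exists (R : realType) (r : R) : r != 0 ->
  0 < xi r /\ xi r ^+ 2 * ln (xi r) = r ^+ 2 / 4.
Proof.
move=> r0; have c0 : 0 < r ^+ 2 / 4.
  by rewrite divr_gt0// exprn_even_gt0.
set c := r ^+ 2 / 4 in c0 *.
have b1 : 1 <= expR c by rewrite -expR0 ler_expR ltW.
have [||z] := @IVT R (fun z => z ^+ 2 * ln z) 1 (expR c) c b1.
- apply: continuous_in_subspaceT => z; rewrite inE/= in_itv/= => /andP[z1 _].
  apply: cvgM; first exact: exprn_continuous.
  by apply: continuous_ln; exact: lt_le_trans z1.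
- rewrite ln1 mulr0 expRK ge_min ltW//= le_max; apply/orP; right.
  by rewrite ler_peMl ?(ltW c0)// exprn_ege1.
rewrite in_itv/= => /andP[z1 _] zc.
have z0 : 0 < z by exact: lt_le_trans z1.
by rewrite -(xi_unique r0 z0 zc).
Qed.

Definition PhiG (R : realType) (r : R) : R :=
  1 + 2 * xi r * ln (xi r) - xi r.

Canonical pinfty_filter (R : realType) := @FilterType R (pinfty_nbhs R) _.

(* Main.v *)
Require Import Defs.
From HB Require Import structures.
From mathcomp Require Import all_boot all_order all_algebra.
From mathcomp Require Import all_classical all_reals all_analysis.
From mathcomp Require Import measurable_realfun.
From mathcomp Require Import ring lra.

Set Implicit Arguments.
Unset Strict Implicit.
Unset Printing Implicit Defensive.

Import Order.TTheory GRing.Theory Num.Theory.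
Import numFieldTopology.Exports numFieldNormedType.Exports.

Local Open Scope classical_set_scope.
Local Open Scope ring_scope.

(** Every convolution power of the Gaussian is again a Gaussian,
    [a^{*k} (x) = (4 pi k)^(-d/2) exp (- |x|^2 / (4 k))] (lemma
    [conv_pow_gauss]).  Hence [v x t] is the expectation of the heat kernel
    [heat x N] at a random time [N] that has the Poisson law of mean [t], the
    event [N = 0] being discarded (lemma [v_poisson_mean]).

    Large [|x|].  With [t z] for the random time, the Poisson weight and the
    Gaussian factor contribute together the exponential of
    [- t (z ln z - z + 1 + (|x| / t)^2 / (4 z))]; the bracket is minimal where
    [z^2 ln z = (|x| / t)^2 / 4], that is at [z = xi (|x| / t)], and its minimum
    is [PhiG (|x| / t)].  This heuristic is exact up to a logarithm:
    - [v x t <= exp (- t PhiG (|x| / t))], because [1 / k] lies above its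
      tangent lines, and the tangent at [t z] turns the Gaussian factor into a
      geometric one, whose Poisson mean is explicit (lemma [v_ub]);
    - the single term of index close to [t z] already gives
      [v x t >= exp (- t PhiG (|x| / t) - C (1 + ln (t z)))] (lemma [v_lb]).
    So [- ln v] is [t PhiG (|x| / t)] in all the regimes where the logarithm is
    negligible (lemma [ln_v_equiv]), and the regimes differ only by the size of
    [|x| / t]: it tends to 0 (where [PhiG r] is equivalent to [r^2 / 4]), is
    constant, or tends to infinity (where [PhiG r] is equivalent to
    [r sqrt (ln r)]).  Both equivalents come from elementary two-sided bounds on
    [PhiG], namely [PhiG_ge_small] and [PhiG_lt], and [PhiG_large].

    Small [|x|].  When [|x|^2 / t] stays bounded, the ratio
    [heat x k / heat x t] is a Lipschitz function of [k / t] as long as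
    [k >= t / 2].  The standard deviation of [N / t] being [t^(-1/2)], the
    relative error of [v] with respect to the heat kernel is [O (t^(-1/2))]; the
    indices [k < t / 2] only contribute an exponentially small amount (lemma
    [v_over_heat]). *)

(** * Convolution powers of the Gaussian *)

(** The heat kernel of the line at time [s], i.e. the centred normal density of
    variance [2 * s]. *)
Definition heat1 (R : realType) (s z : R) : R :=
  (Num.sqrt (4 * pi * s))^-1 * expR (- (z ^+ 2 / (4 * s))).

Lemma heat1_ge0 (R : realType) (s z : R) : 0 <= heat1 s z.
Proof. by rewrite mulr_ge0 ?invr_ge0 ?sqrtr_ge0 ?expR_ge0. Qed.

Lemma measurable_heat1 (R : realType) (s : R) : 
  measurable_fun [set: measurableTypeR R] (heat1 s).
Proof.
apply: measurable_funM => //; apply: measurableT_comp => //=.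
apply: measurableT_comp => //=; apply: measurable_funM => //=.
Qed.

(** Completing the square in [y]: [(x - y)^2 / (4 a) + y^2 / (4 b)] is
    [x^2 / (4 (a + b))] plus a square centred at [b x / (a + b)], so the product
    is proportional to a normal density in [y]. *)
Lemma heat1_mul (R : realType) (a b x y : R) : 0 < a -> 0 < b ->
  heat1 a (x - y) * heat1 b y = heat1 (a + b) x *
    normal_pdf (b * x / (a + b)) (Num.sqrt (2 * a * b / (a + b))) y.
Proof.
move=> a0 b0; have ab0 : 0 < a + b by rewrite addr_gt0.
have s0 : 0 < 2 * a * b / (a + b) by rewrite divr_gt0 ?mulr_gt0.
rewrite normal_pdfE ?gt_eqF ?sqrtr_gt0// /normal_peak /normal_fun /heat1.
rewrite sqr_sqrtr ?ltW// mulrACA [RHS]mulrACA -!invfM -!expRD.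
rewrite -!sqrtrM ?mulr_ge0 ?pi_ge0 ?ltW//.
congr ((Num.sqrt _)^-1 * expR _); field; rewrite ?gt_eqF//.
Qed.

Lemma integral_heat1 (R : realType) (a b x : R) : 0 < a -> 0 < b ->
  (\int[lebesgue_measure]_y (heat1 a (x - y) * heat1 b y)%:E =
   (heat1 (a + b) x)%:E)%E.
Proof.
move=> a0 b0; under eq_integral do rewrite heat1_mul// EFinM.
rewrite integralZl//; last exact: integrable_normal_pdf.
by rewrite integral_normal_pdf mule1.
Qed.

(** Tonelli's theorem, one coordinate at a time; it reduces the convolution on
    [R^d] of functions with separated variables to the convolution on the
    line. *)
Lemma integral_lebesgue_tuple_prod (R : realType) (d : nat)
    (h : 'I_d -> measurableTypeR R -> R) :
  (forall i, measurable_fun setT (h i)) -> (forall i s, 0 <= h i s) ->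
  (\int[lebesgue_tuple R d]_y (\prod_(i < d) h i (tnth y i))%:E =
   \prod_(i < d) \int[lebesgue_measure]_s (h i s)%:E)%E.
Proof.
elim: d h => [|d IH] h mh h0 /=.
  under eq_integral do rewrite big_ord0.
  by rewrite big_ord0 integral_cst// mul1e; exact: diracT.
have mtup n (g : 'I_n -> measurableTypeR R -> R) : (forall i, measurable_fun setT (g i)) ->
    measurable_fun [set: n.-tuple (measurableTypeR R)]
      (fun y => (\prod_(i < n) g i (tnth y i))%:E).
  move=> mg; apply/measurable_EFinP.
  apply: (@measurable_prod _ _ _ _ _ (index_enum 'I_n)
    (fun i (y : n.-tuple (measurableTypeR R)) => g i (tnth y i))) => i _.
  apply: (measurableT_comp (mg i)). exact: (measurable_tnth (T := measurableTypeR R) i).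
rewrite /lebesgue_cons ge0_integral_pushforward//=; first last.
- by move=> y _; rewrite lee_fin prodr_ge0.
- exact: mtup.
- exact: measurable_tuple_cons.
rewrite preimage_setT.
under eq_integral => p _.
  rewrite /= big_ord_recl EFinM (_ : tnth (tuple_cons p) ord0 = p.1)//.
  under eq_bigr do rewrite tnthS.
  over.
rewrite /= fubini_tonelli1//=; first last.
- by move=> p; rewrite mule_ge0// lee_fin// prodr_ge0.
- apply: emeasurable_funM.
    apply/measurable_EFinP; apply: (measurableT_comp (mh ord0)).
    exact: measurable_fst.
  have mt := mtup d (fun i => h (lift ord0 i)) (fun i => mh (lift ord0 i)).
  exact: (measurableT_comp mt measurable_snd).
rewrite /fubini_F /= big_ord_recl -IH//.
under eq_integral => s _.
  rewrite ge0_integralZl//=; first over.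
  - exact: (mtup d (fun i => h (lift ord0 i))).
  - by move=> y _; rewrite lee_fin prodr_ge0.
  - by rewrite lee_fin.
rewrite /= ge0_integralZr//.
- exact/measurable_EFinP.
- by move=> s _; rewrite lee_fin.
- by apply: integral_ge0 => y _; rewrite lee_fin prodr_ge0.
Qed.

Lemma enorm_sqr (R : realType) (d : nat) (x : d.-tuple R) :
  enorm x ^+ 2 = \sum_(i < d) tnth x i ^+ 2.
Proof. by rewrite sqr_sqrtr// sumr_ge0// => i _; rewrite sqr_ge0. Qed.

Lemma prod_heat1 (R : realType) (d : nat) (s : R) (x : d.-tuple R) : 0 < s ->
  \prod_(i < d) heat1 s (tnth x i) =
  ((4 * pi * s) `^ (d%:R / 2))^-1 * expR (- (enorm x ^+ 2 / (4 * s))).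
Proof.
move=> s0; have p0 : 0 <= 4 * pi * s by rewrite !mulr_ge0 ?pi_ge0// ltW.
rewrite big_split/= prodr_const card_ord -expR_sum; congr (_ * expR _).
  by rewrite [d%:R / 2]mulrC powRrM powR12_sqrt// powR_mulrn ?sqrtr_ge0// exprVn.
by rewrite enorm_sqr mulr_suml -sumrN.
Qed.

(** The semigroup property of the heat kernel: the Gaussian is the heat kernel
    at time 1, and each convolution adds 1 to the time. *)
Lemma conv_pow_gauss (R : realType) (d k : nat) (x : d.-tuple R) : (0 < k)%N ->
  conv_pow (@gauss R d) k x =
  ((4 * pi * k%:R) `^ (d%:R / 2))^-1 * expR (- (enorm x ^+ 2 / (4 * k%:R))).
Proof.
case: k => // k _; rewrite -prod_heat1//; elim: k x => [|k IH] x.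
  by rewrite prod_heat1// !mulr1.
rewrite /conv_pow /= -/(conv_pow (@gauss R d) k.+1) /conv.
transitivity (fine (\int[lebesgue_tuple R d]_y
   (\prod_(i < d) (heat1 1 (tnth x i - tnth y i) * heat1 k.+1%:R (tnth y i)))%:E)%E).
  congr fine; apply: eq_integral => y _; rewrite IH; congr EFin.
  rewrite [RHS]big_split; congr (_ * _); rewrite /gauss.
  have := prod_heat1 (tuple_sub x y) ltr01; rewrite !mulr1 => <-.
  by apply: eq_bigr => i _; rewrite tnth_mktuple.
rewrite (integral_lebesgue_tuple_prod (h := fun i s =>
   heat1 1 (tnth x i - s) * heat1 k.+1%:R s)).
- rewrite (eq_bigr (fun i => (heat1 (1 + k.+1%:R) (tnth x i))%:E)); last first.
    by move=> i _; apply: integral_heat1.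
  by rewrite prodEFin/= (natrD _ 1 k.+1).
- move=> i; apply: measurable_funM; last exact: measurable_heat1.
  apply: (@measurableT_comp _ _ _ _ _ _ _ _ _ (measurable_heat1 1)).
  exact: measurable_funB.
- by move=> i s; rewrite mulr_ge0 ?heat1_ge0.
Qed.

(** * The rate function *)

Section rate_function.
Variable R : realType.
Implicit Types r z : R.

Lemma ln_ge1BV z : 0 < z -> 1 - z^-1 <= ln z.
Proof.
move=> z0; have := @le_ln1Dx R (z^-1 - 1).
rewrite [1 + _]addrC subrK ltrBrDr addNr invr_gt0 => /(_ z0).
by rewrite lnV ?posrE//; lra.
Qed.

Lemma ln_leB1 z : 0 < z -> ln z <= z - 1.
Proof.
move=> z0; have := @le_ln1Dx R (z - 1).
by rewrite [1 + _]addrC subrK => -> //; lra.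
Qed.

Lemma xi_gt1 r : r != 0 -> 1 < xi r.
Proof.
move=> r0; have [x0 xe] := xi_exists r0.
have c0 : 0 < r ^+ 2 / 4 by rewrite divr_gt0// exprn_even_gt0.
rewrite ltNge; apply/negP => x1; move: c0; rewrite -xe ltNge => /negP; apply.
by rewrite mulr_ge0_le0 ?sqr_ge0 ?ln_le0.
Qed.

Lemma ln_xi_gt0 r : r != 0 -> 0 < ln (xi r).
Proof. by move=> r0; rewrite ln_gt0 ?xi_gt1. Qed.

(** As [ln z >= 1 - 1 / z], the negative part [1 - xi] of [PhiG] is absorbed by
    half of [2 xi ln xi]; what remains is [xi ln xi], which the equation of [xi]
    identifies with the left-hand side. *)
Lemma PhiG_ge r : r != 0 -> r ^+ 2 / 4 / xi r <= PhiG r.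
Proof.
move=> r0; have [x0 <-] := xi_exists r0.
have -> : xi r ^+ 2 * ln (xi r) / xi r = xi r * ln (xi r).
  by field; rewrite gt_eqF.
rewrite /PhiG.
have := ln_ge1BV x0; rewrite -(ler_pM2l x0) mulrBr mulfV ?gt_eqF//.
by rewrite mulr1 -mulrA; set a := xi r; set b := a * _; lra.
Qed.

Lemma PhiG_gt0 r : r != 0 -> 0 < PhiG r.
Proof.
move=> r0; apply: lt_le_trans (PhiG_ge r0).
by rewrite !divr_gt0 ?exprn_even_gt0// (lt_trans ltr01 (xi_gt1 r0)).
Qed.

(** With [r^2 / 4 = xi^2 ln xi], the difference of the two sides is
    [(xi - 1)^2 ln xi + (xi - 1 - ln xi)]. *)
Lemma PhiG_lt r : r != 0 -> PhiG r < r ^+ 2 / 4.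
Proof.
move=> r0; have [x0 <-] := xi_exists r0; rewrite /PhiG.
have := ln_leB1 x0; have := xi_gt1 r0; have := ln_xi_gt0 r0.
set a := xi r; set b := ln a => b0 a1 ba.
have : 0 < (a - 1) ^+ 2 * b by rewrite mulr_gt0// exprn_gt0 ?subr_gt0.
nra.
Qed.

Lemma xi_le_expR r : r != 0 -> xi r <= expR (r ^+ 2 / 4).
Proof.
move=> r0; have [x0 xe] := xi_exists r0.
rewrite -[leLHS]lnK ?posrE// ler_expR -xe ler_peMl ?(ltW (ln_xi_gt0 _))//.
by rewrite exprn_ege1// ltW ?xi_gt1.
Qed.

Lemma PhiG_ge_small r : r != 0 -> r ^+ 2 / 4 * (1 - r ^+ 2 / 4) <= PhiG r.
Proof.
move=> r0; apply: le_trans (PhiG_ge r0).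
rewrite ler_wpM2l ?divr_ge0 ?sqr_ge0//.
apply: (@le_trans _ _ (expR (- (r ^+ 2 / 4)))); first exact: expR_ge1Dx.
by rewrite expRN lef_pV2 ?posrE ?expR_gt0 ?xi_le_expR// (lt_trans ltr01 (xi_gt1 r0)).
Qed.

(** The threshold [2 * expR 1] is the value of [r] for which [xi r] is
    [expR 1]. *)
Lemma ln_xi_ge1 r : 2 * expR 1 <= r -> 1 <= ln (xi r).
Proof.
move=> re; have e0 := expR_gt0 (1 : R).
have r0 : r != 0 by rewrite gt_eqF//; apply: lt_le_trans re; rewrite mulr_gt0.
have [x0 xe] := xi_exists r0; rewrite leNgt; apply/negP => l1.
have l0 := ln_xi_gt0 r0.
have : xi r < expR 1 by rewrite -[ltLHS]lnK ?posrE// ltr_expR.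
move: xe l1 l0 x0 re e0; set a := xi r; set l := ln a; set e := expR 1.
move=> ae l1 l0 a0 er e0 lae.
have : a ^+ 2 * l < e ^+ 2.
  apply: (@lt_trans _ _ (a ^+ 2)); first by rewrite gtr_pMr ?exprn_gt0.
  by rewrite ltr_pXn2r// nnegrE ltW.
rewrite ae; nra.
Qed.

Lemma xi_sqrt r : 0 < r -> r = 2 * xi r * Num.sqrt (ln (xi r)).
Proof.
move=> r0; have r0' : r != 0 by rewrite gt_eqF.
have [x0 xe] := xi_exists r0'; have l0 := ln_xi_gt0 r0'.
apply/eqP; rewrite -(eqrXn2 (n := 2))//.
rewrite exprMn sqr_sqrtr ?(ltW l0)// exprMn -mulrA xe; apply/eqP; first field.
all: by rewrite ?ltW// !mulr_gt0// sqrtr_gt0.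
Qed.

Lemma xi_le r : 2 * expR 1 <= r -> xi r <= r.
Proof.
move=> re; have r0 : 0 < r by apply: lt_le_trans re; rewrite mulr_gt0 ?expR_gt0.
have l1 := ln_xi_ge1 re; have s1 : 1 <= Num.sqrt (ln (xi r)).
  by rewrite -sqrtr1 ler_wsqrtr.
have [x0 _] := xi_exists (lt0r_neq0 r0).
by rewrite [leRHS]xi_sqrt//; nra.
Qed.

Lemma ln_le_sqrt z : 0 < z -> ln z <= 2 * Num.sqrt z.
Proof.
move=> z0; have s0 : 0 < Num.sqrt z by rewrite sqrtr_gt0.
rewrite -[in leLHS](sqr_sqrtr (ltW z0)) lnXn// -[ln _ *+ 2]mulr_natl.
by rewrite ler_pM2l// ltW ?ln_sublinear.
Qed.

(** Taking logarithms in [r = 2 xi sqrt (ln xi)] gives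
    [ln r = ln xi + ln (ln xi) / 2 + ln 2]: at first order [ln r] and [ln xi]
    agree. *)
Lemma ln_le_xi r : 2 * expR 1 <= r -> ln (xi r) <= ln r <=
  ln (xi r) + Num.sqrt (ln (xi r)) + 1.
Proof.
move=> re; have r0 : 0 < r by apply: lt_le_trans re; rewrite mulr_gt0 ?expR_gt0.
have [x0 _] := xi_exists (lt0r_neq0 r0); have l0 := ln_xi_gt0 (lt0r_neq0 r0).
rewrite ler_ln ?posrE// xi_le//=.
have s0 : 0 < Num.sqrt (ln (xi r)) by rewrite sqrtr_gt0.
rewrite [in leLHS](xi_sqrt r0) !lnM ?posrE ?mulr_gt0//.
have -> : ln (Num.sqrt (ln (xi r))) = ln (ln (xi r)) / 2.
  by rewrite -powR12_sqrt ?ltW// ln_powR mulrC.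
have := ln_le_sqrt l0; have : ln (2 : R) <= 2 - 1 by rewrite ln_leB1.
by set a := ln 2; set b := ln (ln _); set c := Num.sqrt _; lra.
Qed.

(** Here [PhiG r = r sqrt (ln xi) (1 - (xi - 1) / (2 xi ln xi))]; replacing
    [ln xi] by [ln r] in this identity costs the error terms on the left. *)
Lemma PhiG_large r : 2 * expR 1 <= r ->
  1 - (Num.sqrt (ln r))^-1 - 3 / 2 * (ln r)^-1
    <= PhiG r / (r * Num.sqrt (ln r)) <= 1.
Proof.
move=> re; have r0 : 0 < r by apply: lt_le_trans re; rewrite mulr_gt0 ?expR_gt0.
have r0' := lt0r_neq0 r0.
have [x0 _] := xi_exists r0'; have l1 := ln_xi_ge1 re.
have /andP[lq ql] := ln_le_xi re; have x1 := xi_gt1 r0'; have rE := xi_sqrt r0.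
rewrite /PhiG; set x := xi r in x0 l1 lq ql x1 rE *.
set l := ln x in l1 lq ql rE *; set q := ln r in lq ql *.
have q0 : 0 < q by lra.
have sq0 : 0 < Num.sqrt q by rewrite sqrtr_gt0.
have sl0 : 0 < Num.sqrt l by rewrite sqrtr_gt0; lra.
have slq : Num.sqrt l <= Num.sqrt q by rewrite ler_wsqrtr.
have sqE : Num.sqrt q ^+ 2 = q by rewrite sqr_sqrtr ?ltW.
have slE : Num.sqrt l ^+ 2 = l by rewrite sqr_sqrtr//; lra.
have d0 : 0 < r * Num.sqrt q by rewrite mulr_gt0.
rewrite rE; clearbody l q; move: sq0 sl0 slq sqE slE ql {rE d0}.
set s := Num.sqrt q; set m := Num.sqrt l => s0 m0 ms sqE slE ql.
rewrite -[in (_ * q^-1)]sqE; rewrite -slE -sqE in ql; rewrite -slE in l1.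
apply/andP; split; last first.
  rewrite ler_pdivrMr ?mulr_gt0// mul1r -slE.
  have : x * m * m <= x * m * s by rewrite ler_pM2l// mulr_gt0.
  nra.
have m1 : 1 <= m by rewrite -(ler_pXn2r (n := 2))// ?nnegrE ?expr1n// ltW.
rewrite ler_pdivlMr ?mulr_gt0//.
have -> : (1 - s^-1 - 3 / 2 * (s ^+ 2)^-1) * (2 * x * m * s) =
   (s ^+ 2 - s - 3/2) * (2 * x * (m / s)).
  by field; rewrite gt_eqF.
have ms1 : m / s <= 1 by rewrite ler_pdivrMr// mul1r.
have ms0 : 0 < m / s by rewrite divr_gt0.
have h1 : s ^+ 2 - s - 3 / 2 <= m ^+ 2 - 1 / 2 by nra.
apply: (@le_trans _ _ ((m ^+ 2 - 1 / 2) * (2 * x * (m / s)))).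
  by apply: ler_wpM2r h1; rewrite ltW// mulr_gt0// mulr_gt0.
apply: (@le_trans _ _ ((m ^+ 2 - 1 / 2) * (2 * x))); last by rewrite -slE; nra.
apply: ler_wpM2l; first nra.
by rewrite ler_piMr// mulr_ge0// ltW.
Qed.

End rate_function.

(** * Means under the Poisson law *)

Section poisson_mean.
Variable R : realType.
Implicit Types (t a b c : R) (f g : nat -> R).

(** [m] is the expectation of [f] under the Poisson law of mean [t].  It is a
    relation and not a function, so that integrability need not be carried
    around separately; the factor [expR t] stands on the right-hand side to leave
    a plain power series on the left. *)
Definition poisson_mean t f m : Prop :=
  series (fun k => t ^+ k / k`!%:R * f k) @ \oo --> expR t * m.

Lemma cvg_exp_series t : series (exp_coeff t) @ \oo --> expR t.
Proof. exact: is_cvg_series_exp_coeff. Qed.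

Lemma eq_poisson_mean t f g m : f =1 g -> poisson_mean t f m -> poisson_mean t g m.
Proof. by move=> /funext ->. Qed.

Lemma poisson_meanZ t c f m :
  poisson_mean t f m -> poisson_mean t (fun k => c * f k) (c * m).
Proof.
move=> fm; rewrite /poisson_mean mulrCA.
rewrite (_ : series _ = fun n => c * series (fun k => t ^+ k / k`!%:R * f k) n).
  exact: cvgMl_tmp.
apply/funext => n; rewrite /series /= mulr_sumr.
by apply: eq_bigr => k _; rewrite mulrCA.
Qed.

Lemma poisson_meanD t f g a b : poisson_mean t f a -> poisson_mean t g b ->
  poisson_mean t (fun k => f k + g k) (a + b).
Proof.
move=> fa gb; rewrite /poisson_mean mulrDr.
rewrite (_ : series _ = series (fun k => t ^+ k / k`!%:R * f k) \+
                        series (fun k => t ^+ k / k`!%:R * g k)).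
  exact: cvgD.
apply/funext => n; rewrite /series /= -big_split.
by apply: eq_bigr => k _; rewrite mulrDr.
Qed.

Lemma le_poisson_mean t f g a b : 0 <= t -> (forall k, f k <= g k) ->
  poisson_mean t f a -> poisson_mean t g b -> a <= b.
Proof.
move=> t0 fg fa gb; rewrite -(ler_pM2l (expR_gt0 t)).
apply: (ler_cvg_to fa gb); apply: nearW => n.
by apply: ler_sum => k _; rewrite ler_wpM2l ?divr_ge0 ?exprn_ge0.
Qed.

Lemma poisson_mean_geX t z : poisson_mean t (fun k => z ^+ k) (expR (t * (z - 1))).
Proof.
rewrite /poisson_mean -expRD (_ : t + _ = t * z); last by ring.
rewrite (_ : series _ = series (exp_coeff (t * z))); first exact: cvg_exp_series.
congr series; apply/funext => k; rewrite /exp_coeff /= exprMn; ring.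
Qed.

Lemma poisson_mean1 t : poisson_mean t (fun=> 1) 1.
Proof.
have := @poisson_mean_geX t 1; rewrite subrr mulr0 expR0.
by apply: eq_poisson_mean => k; rewrite expr1n.
Qed.

(** The size-biasing identity of the Poisson law; it yields all the factorial
    moments from the mass by iteration. *)
Lemma poisson_mean_shift t f m :
  poisson_mean t f m -> poisson_mean t (fun k => k%:R * f k.-1) (t * m).
Proof.
move=> fm; rewrite /poisson_mean -cvg_shiftS mulrCA.
rewrite (_ : (fun n => _) = fun n => t * series (fun k => t ^+ k / k`!%:R * f k) n).
  exact: cvgMl_tmp.
apply/funext => n; rewrite /series /= big_nat_recl// mul0r mulr0 add0r mulr_sumr.
apply: eq_bigr => k _; rewrite /= exprS factS natrM; field.
by rewrite nat1r !pnatr_eq0 -lt0n fact_gt0.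
Qed.

(** The variance, from [(N - t)^2 = N (N - 1) + (1 - 2 t) N + t^2]. *)
Lemma poisson_mean_sqdev t : poisson_mean t (fun k => (k%:R - t) ^+ 2) t.
Proof.
have m0 := @poisson_mean1 t.
have m1 := poisson_mean_shift m0.
have m2 := poisson_mean_shift m1.
have := poisson_meanD m2 (poisson_meanD (@poisson_meanZ _ (1 - 2 * t) _ _ m1)
  (@poisson_meanZ _ (t ^+ 2) _ _ m0)).
rewrite (_ : _ + _ = t); last by ring.
apply: eq_poisson_mean => -[|k] /=; first by ring.
by rewrite -natr1; ring.
Qed.

Lemma poisson_mean_term t f m (k : nat) : 0 <= t -> (forall n, 0 <= f n) ->
  poisson_mean t f m -> expR (- t) * (t ^+ k / k`!%:R * f k) <= m.
Proof.
move=> t0 f0 fm; rewrite expRN ler_pdivrMl ?expR_gt0//.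
have u0 n : 0 <= t ^+ n / n`!%:R * f n by rewrite !mulr_ge0 ?exprn_ge0 ?invr_ge0.
rewrite -(cvg_lim _ fm)//.
apply: (@le_trans _ _ (series (fun k => t ^+ k / k`!%:R * f k) k.+1)).
  by rewrite /series /= big_nat_recr//= lerDr sumr_ge0.
apply: nondecreasing_cvgn_le; last by apply/cvg_ex; exists (expR t * m).
by apply/nondecreasing_seqP => n; rewrite /series /= big_nat_recr//= lerDl.
Qed.

Lemma poisson_mean_exists t f : 0 <= t -> (forall n, 0 <= f n <= 1) ->
  exists m, poisson_mean t f m.
Proof.
move=> t0 f01; have w0 n : 0 <= t ^+ n / n`!%:R by rewrite divr_ge0 ?exprn_ge0.
pose u := series (fun k => t ^+ k / k`!%:R * f k).
have cu : cvgn u.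
  apply: nondecreasing_is_cvgn.
    apply/nondecreasing_seqP => n; rewrite /u /series /= big_nat_recr//= lerDl.
    by have /andP[? _] := f01 n; rewrite mulr_ge0.
  exists (expR t) => _ [n _ <-].
  apply: (@le_trans _ _ (series (exp_coeff t) n)).
    apply: ler_sum => k _; have /andP[_ ?] := f01 k.
    by rewrite /exp_coeff /= ler_piMr.
  apply: nondecreasing_cvgn_le; last exact: is_cvg_series_exp_coeff.
  by apply/nondecreasing_seqP => k; rewrite /series /= big_nat_recr//= lerDl; exact: w0.
exists ((expR t)^-1 * limn u).
by rewrite /poisson_mean mulVKf// gt_eqF ?expR_gt0.
Qed.

End poisson_mean.

Arguments poisson_meanZ {R t} c {f m} _.
Arguments poisson_mean_geX {R} t z.
Arguments poisson_mean1 {R} t.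
Arguments poisson_mean_sqdev {R} t.

(** * The density as a Poisson mean of heat kernels *)

Section heat_kernel_series.
Variables (R : realType) (d : nat).
Implicit Types (x : d.-tuple R) (t s : R).

Definition heat x s : R :=
  ((4 * pi * s) `^ (d%:R / 2))^-1 * expR (- (enorm x ^+ 2 / (4 * s))).

Lemma heat_gt0 x s : 0 < s -> 0 < heat x s.
Proof.
by move=> s0; rewrite mulr_gt0 ?expR_gt0// invr_gt0 powR_gt0 ?mulr_gt0 ?pi_gt0.
Qed.

Lemma heat_le1 x s : 1 <= s -> heat x s <= expR (- (enorm x ^+ 2 / (4 * s))).
Proof.
move=> s1; have p2 := @pi_ge2 R; have p1 : 1 <= 4 * pi * s by nra.
rewrite ler_piMl ?expR_ge0// invf_le1 ?powR_gt0 ?(lt_le_trans ltr01)//.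
by rewrite -[leLHS](powRr0 (4 * pi * s)) ler_powR// divr_ge0.
Qed.

(** The series that defines [v] starts at 1, whence the value 0 at [k = 0], where
    the formula of [heat] is meaningless. *)
Definition heat_at x (k : nat) : R := (0 < k)%N%:R * heat x k%:R.

Lemma heat_at0 x : heat_at x 0 = 0.
Proof. by rewrite /heat_at ltnn mul0r. Qed.

Lemma heat_atS x k : (0 < k)%N -> heat_at x k = heat x k%:R.
Proof. by move=> k0; rewrite /heat_at k0 mul1r. Qed.

Lemma heat_at_ge0 x k : 0 <= heat_at x k.
Proof. by rewrite /heat_at; case: k => [|k]; rewrite ?mul0r// mul1r ltW ?heat_gt0. Qed.

Lemma heat_at_le x k : heat_at x k <= expR (- (enorm x ^+ 2 / (4 * k%:R))).
Proof.
rewrite /heat_at; case: k => [|k]; first by rewrite mul0r expR_ge0.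
by rewrite mul1r heat_le1// ler1n.
Qed.

Lemma heat_at_01 x k : 0 <= heat_at x k <= 1.
Proof.
rewrite heat_at_ge0 (le_trans (heat_at_le x k))// -[leRHS]expR0 ler_expR oppr_le0.
by rewrite divr_ge0 ?sqr_ge0.
Qed.

Lemma v_poisson_mean x t : 0 <= t -> poisson_mean t (heat_at x) (v x t).
Proof.
move=> t0; have [m hm] := poisson_mean_exists t0 (heat_at_01 x).
suff <- : m = v x t by [].
rewrite /v (_ : limn _ = expR t * m); first by rewrite mulrA -expRD addNr expR0 mul1r.
apply/cvg_lim => //; rewrite -cvg_shiftS.
rewrite (_ : (fun n => _) =
    fun n => series (fun k => t ^+ k / k`!%:R * heat_at x k) n.+1).
  by move: hm; rewrite /poisson_mean => hm; rewrite -cvg_shiftS in hm.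
apply/funext => n; rewrite /series /= [RHS]big_nat_recl// heat_at0 mulr0 add0r.
rewrite big_add1 /=; apply: eq_bigr => k _.
by rewrite heat_atS// conv_pow_gauss// mulrAC.
Qed.

End heat_kernel_series.

Arguments v_poisson_mean {R d} x {t} _.

(** * Exponential bounds with the rate function *)

Section large_deviations.
Variables (R : realType) (d : nat).
Implicit Types (x : d.-tuple R) (t : R).

(** The tangent of [k |-> 1 / k] at [t z], where [z = xi (|x| / t)], gives
    [|x|^2 / (4 k) >= 2 t z ln z - k ln z]; so each heat kernel is at most a
    multiple of [z ^+ k], and the Poisson mean of a geometric sequence is
    explicit. *)
Lemma v_ub x t : 0 < t -> 0 < enorm x -> v x t <= expR (- (t * PhiG (enorm x / t))).
Proof.
move=> t0 x0; set rho := enorm x / t.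
have rho0 : rho != 0 by rewrite gt_eqF ?divr_gt0.
have [z0 ze] := xi_exists rho0; set z := xi rho in z0 ze *.
have x2 : enorm x ^+ 2 = 4 * t ^+ 2 * (z ^+ 2 * ln z).
  by rewrite ze /rho; field; rewrite gt_eqF.
have l0 : 0 < ln z by exact: ln_xi_gt0.
pose g k := expR (- (2 * t * z * ln z)) * z ^+ k.
have gm : poisson_mean t g (expR (- (t * PhiG rho))).
  rewrite (_ : expR _ = expR (- (2 * t * z * ln z)) * expR (t * (z - 1))).
    by apply: poisson_meanZ; exact: poisson_mean_geX.
  by rewrite -expRD /PhiG -/z; congr expR; ring.
suff fg k : heat_at x k <= g k by exact: le_poisson_mean (ltW t0) fg (v_poisson_mean x (ltW t0)) gm.
case: k => [|k]; first by rewrite heat_at0 mulr_ge0 ?exprn_ge0 ?expR_ge0 ?ltW.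
apply: (le_trans (heat_at_le _ _)).
rewrite /g -[in z ^+ _](lnK (x := z)) ?posrE// -expRM_natl -expRD ler_expR.
set n : R := k.+1%:R; have n0 : 0 < n by rewrite ltr0n.
rewrite x2 lerNl opprD opprK -subr_ge0.
rewrite (_ : _ - _ = ln z * (t * z - n) ^+ 2 / n); last first.
  by field; rewrite gt_eqF.
by rewrite divr_ge0 ?(ltW n0)// mulr_ge0 ?sqr_ge0// ltW.
Qed.

(** A one-sided Stirling estimate, [k! <= e k (k / e)^k]; the superfluous factor
    of order [sqrt k] is harmless, since logarithmic errors are negligible. *)
Lemma ln_fact_le (k : nat) : (0 < k)%N ->
  ln (k`!%:R : R) <= k%:R * ln k%:R - k%:R + ln k%:R + 1.
Proof.
case: k => // k _; elim: k => [|k IH]; first by rewrite ln1; lra.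
rewrite factS natrM lnM ?posrE ?ltr0n ?fact_gt0//.
have k0 : 0 < k.+1%:R :> R by rewrite ltr0n.
have k1 : 0 < k.+2%:R :> R by rewrite ltr0n.
have := @ln_ge1BV R (k.+2%:R / k.+1%:R) (divr_gt0 k1 k0).
rewrite ln_div ?posrE// invf_div -(ler_pM2l k1) mulrBr mulr1.
rewrite [k.+2%:R * (_ / _)]mulrC divfK ?gt_eqF//.
move: IH; rewrite -[k.+2%:R]natr1; set a := k.+1%:R.
set b := ln a; set c := ln (a + 1); set f := ln _; lra.
Qed.

(** One term of the series suffices.  Rounding the optimal index [t z] up to an
    integer, using Stirling's estimate and the normalisation of the Gaussian all
    cost only [O (1 + ln (t z))] in the exponent. *)
Lemma v_lb : exists2 C : R, 0 <= C & forall x t, 1 <= t -> 0 < enorm x ->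
  expR (- (t * PhiG (enorm x / t) + C * (1 + ln (t * xi (enorm x / t)))))
    <= v x t.
Proof.
exists (4 + d%:R / 2 * (1 + ln (4 * pi))).
  by rewrite addr_ge0// mulr_ge0 ?divr_ge0// addr_ge0// ln_ge0; have := @pi_ge2 R; lra.
move=> x t t1 x0; have t0 : 0 < t by lra.
set rho := enorm x / t.
have rho0 : rho != 0 by rewrite gt_eqF ?divr_gt0.
have [z0 ze] := xi_exists rho0; have z1 := xi_gt1 rho0; rewrite /PhiG.
set z := xi rho in z0 ze z1 *.
have l0 : 0 < ln z by rewrite ln_gt0.
have x2 : enorm x ^+ 2 = 4 * t ^+ 2 * (z ^+ 2 * ln z).
  by rewrite ze /rho; field; rewrite gt_eqF.
have m1 : 1 < t * z by nra.
have m0 : 0 < t * z by lra.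
(* the minimiser of the exponent is [t * z]; rounding up keeps [k >= t z],
   hence does not increase the Gaussian part of the exponent *)
pose k := (Num.truncn (t * z)).+1.
have /andP[km mk] : k%:R - 1 <= t * z < k%:R.
  have /andP[] := truncn_itv (ltW m0).
  by rewrite -/k /k -natr1 addrK => -> ->.
have k0 : 0 < k%:R :> R by rewrite ltr0n.
apply: le_trans (poisson_mean_term k (ltW t0) (heat_at_ge0 x)
  (v_poisson_mean x (ltW t0))).
rewrite heat_atS// /heat.
have p2 := @pi_ge2 R; have p0 : 0 < 4 * pi * k%:R :> R by rewrite !mulr_gt0//; lra.
have f0 : 0 < k`!%:R :> R by rewrite ltr0n fact_gt0.
have -> : t ^+ k = expR (k%:R * ln t) by rewrite expRM_natl lnK.
have -> : k`!%:R = expR (ln k`!%:R) :> R by rewrite lnK.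
rewrite /powR gt_eqF// -!expRN -!expRD ler_expR.
rewrite [ln (_ * k%:R)]lnM ?posrE//; last by rewrite mulr_gt0//; lra.
have kfact := @ln_fact_le k isT.
have lk : ln k%:R <= 1 + ln (t * z).
  apply: (@le_trans _ _ (ln (2 * (t * z)))).
    by rewrite ler_ln ?posrE ?mulr_gt0//; lra.
  rewrite lnM ?posrE// lerD2r; have := @ln_leB1 R 2 (ltr0n _ 2); lra.
have lm0 : 0 < ln (t * z) by rewrite ln_gt0.
have lt0 : 0 <= ln t by rewrite ln_ge0.
have lmE : ln (t * z) = ln t + ln z by rewrite lnM.
(* convexity of [k ln k], which controls the Poisson part of the exponent *)
have lmk : t * z * (ln k%:R - ln (t * z)) <= k%:R - t * z.
  rewrite -ln_div ?posrE//.
  have := @ln_leB1 R (k%:R / (t * z)) (divr_gt0 k0 m0).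
  by rewrite -(ler_pM2l m0) [_ * (_ - 1)]mulrBr mulrC [X in X - _]mulrC divfK ?gt_eqF// mulr1.
have lmk' : ln (t * z) <= ln k%:R by rewrite ler_ln ?posrE// ltW.
have xk : enorm x ^+ 2 / (4 * k%:R) <= t * z * ln z.
  rewrite ler_pdivrMr ?mulr_gt0// x2.
  have : t * z * ln z * (t * z) <= t * z * ln z * k%:R.
    by rewrite ler_pM2l ?mulr_gt0// ltW.
  by lra.
have d0 : 0 <= d%:R / 2 :> R by rewrite divr_ge0.
have pl0 : 0 <= ln (4 * pi) :> R by rewrite ln_ge0//; lra.
have dl : d%:R / 2 * ln k%:R <= d%:R / 2 * (1 + ln (t * z)) by rewrite ler_wpM2l.
have kl : (k%:R - t * z - 1) * (ln k%:R - ln t) <= 0.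
  by apply: mulr_le0_ge0; lra.
have dp : 0 <= d%:R / 2 * ln (4 * pi) * ln (t * z).
  by rewrite !mulr_ge0// ltW.
rewrite lmE in lmk lk dl dp lm0 *.
move: kfact lk lm0 lt0 lmk xk dl kl dp.
set X := _ / (4 * _); set F := ln k`!%:R; set K := ln k%:R; set D := d%:R / 2.
set P := ln (4 * pi); set L := ln z; set T := ln t.
nra.
Qed.

End large_deviations.

(** * Comparison with the heat kernel *)

Section central_region.
Variables (R : realType) (d : nat).
Implicit Types (x : d.-tuple R) (t : R).

Lemma expR_sub1_le (w M : R) : w <= M -> 0 <= M ->
  `|expR w - 1| <= `|w| * expR M.
Proof.
move=> wM M0; have eM : 1 <= expR M by rewrite -expR0 ler_expR.
have [w0|w0] := leP 0 w.
  have e1 : 1 <= expR w by rewrite -expR0 ler_expR.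
  rewrite !ger0_norm ?subr_ge0//; apply: (@le_trans _ _ (w * expR w)).
    have := expR_ge1Dx (- w); rewrite expRN -(ler_pM2l (expR_gt0 w)) mulfV ?gt_eqF ?expR_gt0//.
    by nra.
  by rewrite ler_wpM2l// ler_expR.
have e1 : expR w <= 1 by rewrite -[leRHS]expR0 ler_expR ltW.
rewrite ler0_norm ?subr_le0// ltr0_norm//.
have := expR_ge1Dx w; nra.
Qed.

(** This is the ratio of two heat kernels as a function of the ratio [u] of the
    times.  Its exponent is Lipschitz away from [u = 0], and bounded above by
    [M]: the first term is negative for [u >= 1], the second for [u <= 1]. *)
Lemma profile_lip (p c M u : R) : 0 <= p -> 0 <= c -> p + c <= M -> 1 / 2 <= u ->
  `|expR (- (p * ln u) - c * (u^-1 - 1)) - 1| <= 2 * M * expR M * `|u - 1|.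
Proof.
move=> p0 c0 pcM u2; have u0 : 0 < u by lra.
have ui0 : 0 < u^-1 by rewrite invr_gt0.
have ui : u * u^-1 = 1 by rewrite mulfV ?gt_eqF.
have ui2 : u^-1 <= 2 by nra.
have l1 := ln_leB1 u0; have l2 := ln_ge1BV u0.
have lu : `|ln u| <= 2 * `|u - 1|.
  rewrite ler_norml; have [u1|u1] := leP 1 u.
    by rewrite ger0_norm ?subr_ge0//; apply/andP; split; nra.
  by rewrite ltr0_norm ?subr_lt0//; apply/andP; split; nra.
have vu : `|u^-1 - 1| <= 2 * `|u - 1|.
  rewrite (_ : u^-1 - 1 = u^-1 * (1 - u)); last by rewrite mulrBr mulr1 mulVf ?gt_eqF.
  by rewrite normrM (ger0_norm (ltW ui0)) distrC ler_wpM2r.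
set w := - _ - _.
have wM : w <= M.
  rewrite /w; have [u1|u1] := leP 1 u.
    have : 0 <= ln u by rewrite ln_ge0.
    by nra.
  nra.
have M0 : 0 <= M by lra.
apply: le_trans (expR_sub1_le wM M0) _.
rewrite mulrAC ler_pM2r ?expR_gt0// /w.
apply: le_trans (ler_normB _ _) _; rewrite normrN !normrM.
rewrite (ger0_norm p0) (ger0_norm c0).
have a0 := normr_ge0 (u - 1).
apply: (@le_trans _ _ (p * (2 * `|u - 1|) + c * (2 * `|u - 1|))).
  by apply: lerD; rewrite ler_wpM2l.
by nra.
Qed.

Lemma heatE x (s : R) : 0 < s ->
  heat x s = expR (- (d%:R / 2 * ln (4 * pi * s)) - enorm x ^+ 2 / (4 * s)).
Proof.
move=> s0; rewrite /heat /powR gt_eqF ?mulr_gt0 ?pi_gt0//.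
by rewrite -expRN -expRD.
Qed.

Lemma heat_ratio x (s t : R) : 0 < s -> 0 < t ->
  heat x s / heat x t =
  expR (- (d%:R / 2 * ln (s / t)) - enorm x ^+ 2 / (4 * t) * ((s / t)^-1 - 1)).
Proof.
move=> s0 t0; rewrite !heatE// -expRB; congr expR.
have p0 : 0 < 4 * pi :> R by rewrite mulr_gt0 ?pi_gt0.
rewrite !(lnM (x := 4 * pi)) ?ln_div ?posrE//; field.
by rewrite !gt_eqF.
Qed.

Lemma expR1_gt2 : 2 < expR 1 :> R.
Proof. by have := @expR_gt1Dx R 1 (oner_neq0 _). Qed.

(** The ratio of [v] to the heat kernel is the mean of the ratios
    [heat x k / heat x t].  Each differs from 1 by at most a constant times
    [|k / t - 1|] if [k >= t / 2], and [2 |k / t - 1|] is at most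
    [t^(1/2) (k / t - 1)^2 + t^(-1/2)], whose mean is [2 t^(-1/2)] as the
    variance of the Poisson law is [t].  For [k < t / 2] the ratio is bounded by
    a power of [t], and multiplying the bound by [exp (t / 2 - k)], which is at
    least 1, makes its mean exponentially small. *)
Lemma v_over_heat (r : R) : 0 <= r ->
  exists2 K : R, 0 <= K & forall x t, 1 <= t -> enorm x <= r * Num.sqrt t ->
    `|v x t / heat x t - 1| <= K / Num.sqrt t.
Proof.
move=> r0; set p : R := d%:R / 2; set c1 := r ^+ 2 / 4.
have p0 : 0 <= p by rewrite divr_ge0.
have c10 : 0 <= c1 by rewrite divr_ge0 ?sqr_ge0.
pose C := 2 * (p + c1) * expR (p + c1).
have C0 : 0 <= C by rewrite !mulr_ge0 ?expR_ge0 ?addr_ge0.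
have e2 := expR1_gt2.
(* [kappa > 0] because [expR 1 > 2] *)
pose kappa : R := 1 / 2 - (expR 1)^-1.
have kappa0 : 0 < kappa.
  by rewrite subr_gt0 div1r ltf_pV2 ?posrE ?expR_gt0.
pose K2 := expR c1 * (d.+1`!%:R / kappa ^+ d.+1).
have K20 : 0 <= K2 by rewrite mulr_ge0 ?expR_ge0// divr_ge0// exprn_ge0 ?ltW.
exists (C + K2); first exact: addr_ge0.
move=> x t t1 xr; have t0 : 0 < t by lra.
have s0 : 0 < Num.sqrt t by rewrite sqrtr_gt0.
have s2 : Num.sqrt t ^+ 2 = t by rewrite sqr_sqrtr ?ltW.
set c := enorm x ^+ 2 / (4 * t).
have c0 : 0 <= c by rewrite divr_ge0 ?sqr_ge0// mulr_ge0// ltW.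
have cc1 : c <= c1.
  rewrite /c ler_pdivrMr ?mulr_gt0// (_ : c1 * (4 * t) = (r * Num.sqrt t) ^+ 2).
    by rewrite ler_pXn2r// nnegrE ?sqrtr_ge0 ?mulr_ge0.
  by rewrite exprMn s2 /c1; field.
have g0 := heat_gt0 x t0.
pose D := t `^ p * expR c1.
have tp1 : 1 <= t `^ p by rewrite -[leLHS](powRr0 t) ler_powR.
have D1 : 1 <= D.
  have : 1 <= expR c1 by rewrite -expR0 ler_expR.
  by rewrite /D; nra.
(* the first summand is meant for the indices [k >= t / 2], the second one
   for the others *)
pose B (k : nat) := C / 2 * ((Num.sqrt t)^-1 ^+ 3 * (k%:R - t) ^+ 2 + (Num.sqrt t)^-1 * 1)
    + D * expR (t / 2) * (expR (- 1)) ^+ k.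
have Bm : poisson_mean t B (C / 2 * ((Num.sqrt t)^-1 ^+ 3 * t + (Num.sqrt t)^-1 * 1)
    + D * expR (t / 2) * expR (t * (expR (- 1) - 1))).
  apply: poisson_meanD; apply: poisson_meanZ; last exact: poisson_mean_geX.
  apply: poisson_meanD; apply: poisson_meanZ; last exact: poisson_mean1.
  exact: poisson_mean_sqdev.
have BE : C / 2 * ((Num.sqrt t)^-1 ^+ 3 * t + (Num.sqrt t)^-1 * 1)
    + D * expR (t / 2) * expR (t * (expR (- 1) - 1)) <= (C + K2) / Num.sqrt t.
  rewrite -[D * _ * _]mulrA -expRD (_ : t / 2 + _ = - (kappa * t)); last first.
    by rewrite /kappa expRN; field; rewrite gt_eqF ?expR_gt0.
  rewrite (_ : C / 2 * _ = C / Num.sqrt t); last first.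
    by rewrite -[X in _ * X + _]s2; field; rewrite gt_eqF.
  rewrite [(C + K2) * _]mulrDl lerD2l ler_pdivlMr// expRN mulrAC ler_pdivrMr ?expR_gt0//.
  rewrite /D /K2 [t `^ p * _]mulrC -!mulrA ler_pM2l ?expR_gt0//.
  apply: (@le_trans _ _ (t ^+ d.+1)).
    rewrite -powR12_sqrt ?(ltW t0)// -powRD; last by apply/implyP => _; rewrite gt_eqF.
    rewrite -powR_mulrn ?(ltW t0)// ler_powR// /p -[d.+1%:R]natr1.
    have : 0 <= d%:R :> R by []. lra.
  have h := @expR_ge1Dxn R (kappa * t) d (mulr_ge0 (ltW kappa0) (ltW t0)).
  have f0 : 0 < d.+1`!%:R :> R by rewrite ltr0n fact_gt0.
  rewrite exprMn in h; rewrite mulrCA ler_pdivlMl ?exprn_gt0// -ler_pdivrMl//.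
  by rewrite mulrC; lra.
have fB k : `|heat_at x k / heat x t - 1| <= B k.
  have B1 : 0 <= C / 2 * ((Num.sqrt t)^-1 ^+ 3 * (k%:R - t) ^+ 2 + (Num.sqrt t)^-1 * 1).
    have i0 : 0 <= (Num.sqrt t)^-1 by rewrite invr_ge0 ltW.
    apply: mulr_ge0; first exact: divr_ge0.
    by apply: addr_ge0; apply: mulr_ge0; rewrite ?sqr_ge0 ?exprn_ge0.
  have B2 : 0 <= D * expR (t / 2) * (expR (- 1)) ^+ k.
    by rewrite !mulr_ge0 ?exprn_ge0 ?expR_ge0//; lra.
  have [k2|k2] := leP (t / 2) k%:R.
    have k0 : (0 < k)%N by rewrite -(ltr0n R); lra.
    have k0' : 0 < k%:R :> R by rewrite ltr0n.
    rewrite heat_atS// heat_ratio// -/c -/p.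
    have ut : 1 / 2 <= k%:R / t by rewrite ler_pdivlMr//; lra.
    apply: le_trans (profile_lip p0 c0 (lerD (lexx p) cc1) ut) _.
    rewrite -/C; apply: (@le_trans _ _ (C / 2 *
        ((Num.sqrt t)^-1 ^+ 3 * (k%:R - t) ^+ 2 + (Num.sqrt t)^-1 * 1))); last by rewrite lerDl.
    pose y := (k%:R - t) / Num.sqrt t.
    have -> : k%:R / t - 1 = (Num.sqrt t)^-1 * y.
      rewrite /y; move: s2 s0; set s := Num.sqrt t => s2 s0.
      by rewrite -s2; field; rewrite gt_eqF.
    have -> : (Num.sqrt t)^-1 ^+ 3 * (k%:R - t) ^+ 2 + (Num.sqrt t)^-1 * 1 =
        (Num.sqrt t)^-1 * (`|y| ^+ 2 + 1).
      by rewrite real_normK ?num_real// /y; field; rewrite gt_eqF.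
    have i0 : 0 <= (Num.sqrt t)^-1 by rewrite invr_ge0 ltW.
    rewrite normrM (ger0_norm i0) -mulrA ler_wpM2l// mulrCA ler_wpM2l//.
    have : 0 <= (`|y| - 1) ^+ 2 by exact: sqr_ge0.
    by rewrite sqrrB1; lra.
  apply: (@le_trans _ _ (D * expR (t / 2) * (expR (- 1)) ^+ k)); last by rewrite lerDr.
  have Dk : D <= D * expR (t / 2) * (expR (- 1)) ^+ k.
    rewrite -mulrA ler_peMr//; first lra.
    by rewrite -expRM_natl -expRD -[leLHS]expR0 ler_expR; lra.
  apply: le_trans Dk; case: k k2 B1 B2 => [|k] k2 _ _.
    by rewrite heat_at0 mul0r sub0r normrN1.
  have k0' : 0 < k.+1%:R :> R by rewrite ltr0n.
  have h0 : 0 < heat_at x k.+1 / heat x t by rewrite heat_atS// divr_gt0// heat_gt0.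
  have hD : heat_at x k.+1 / heat x t <= D.
    rewrite heat_atS// heat_ratio// -/c -/p /D /powR gt_eqF// -expRD ler_expR.
    rewrite ln_div ?posrE//.
    have : 0 <= ln k.+1%:R :> R by rewrite ln_ge0// ler1n.
    have : 0 <= (k.+1%:R / t)^-1 by rewrite invr_ge0 divr_ge0// ltW.
    set a := _^-1; set b := ln k.+1%:R => a0 b0.
    have : 0 <= c * a by rewrite mulr_ge0.
    have : 0 <= p * b by rewrite mulr_ge0.
    lra.
  by rewrite ler_norml; apply/andP; split; lra.
have vm := poisson_meanZ (heat x t)^-1 (v_poisson_mean x (ltW t0)).
have vm1 := poisson_meanD vm (poisson_meanZ (- 1) (poisson_mean1 t)).
have vm2 := poisson_meanZ (- 1) vm1.
apply: le_trans BE; rewrite ler_norml; apply/andP; split.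
  rewrite lerNl; apply: le_trans (le_poisson_mean (ltW t0) _ vm2 Bm).
    by rewrite le_eqVlt; apply/orP; left; apply/eqP; rewrite [_ * v _ _]mulrC; ring.
  move=> k; apply: le_trans (fB k); apply: le_trans (ler_norm _) _.
  rewrite -normrN le_eqVlt; apply/orP; left; apply/eqP; congr `| _ |.
  by rewrite [_^-1 * _]mulrC; ring.
apply: le_trans (le_poisson_mean (ltW t0) _ vm1 Bm).
  by rewrite mulrC mulr1.
move=> k; apply: le_trans (fB k); apply: le_trans (ler_norm _) _.
by rewrite mulr1 mulrC.
Qed.

End central_region.

(** * Limits *)

Section asymptotics.
Variable R : realType.

Lemma powR_cvgy (a : R) : 0 < a -> t `^ a @[t --> +oo] --> +oo.
Proof.
move=> a0; apply/cvgryPge => A; near=> t.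
have m0 : 0 <= Num.max A 1 by rewrite le_max ler01 orbT.
apply: (@le_trans _ _ (Num.max A 1)); first by rewrite le_max lexx.
rewrite -[leLHS](powRr1 m0) -[X in _ `^ X <= _](mulVf (lt0r_neq0 a0)) powRrM.
apply: ge0_ler_powR; rewrite ?nnegrE ?powR_ge0 ?(ltW a0)//.
Unshelve. all: by end_near. Qed.

Lemma powRN_cvg0 (a : R) : a < 0 -> t `^ a @[t --> +oo] --> (0 : R).
Proof.
move=> a0; rewrite (_ : (fun t => _) = fun t => (t `^ (- a))^-1); last first.
  by apply/funext => t; rewrite /= -powRN opprK.
apply/(gtr0_cvgV0 (f := fun t => t `^ (- a))); last by apply: powR_cvgy; rewrite oppr_gt0.
by near=> t; rewrite powR_gt0.
Unshelve. all: by end_near. Qed.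

(** [ln t] is [2 / a] times the logarithm of [t `^ (a / 2)], which is at most
    [t `^ (a / 2)]. *)
Lemma ln_powR_cvg0 (c a : R) : 0 < a -> (c + ln t) / t `^ a @[t --> +oo] --> (0 : R).
Proof.
move=> a0.
rewrite (_ : (fun t => _) = fun t => c * t `^ (- a) + ln t * t `^ (- a)); last first.
  by apply/funext => t; rewrite mulrDl powRN.
rewrite -[X in _ --> X]addr0; apply: cvgD.
  by rewrite -[X in _ --> X](mulr0 c); apply: cvgMl_tmp; apply: powRN_cvg0; rewrite oppr_lt0.
apply: (@squeeze_cvgr _ _ _ _ (fun=> 0) (fun t => 2 / a * t `^ (- (a / 2)))).
- near=> t; have t1 : 1 <= t by [].
  have t0 : 0 < t by lra.
  rewrite mulr_ge0 ?ln_ge0 ?powR_ge0//=.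
  have -> : - (a / 2) = a / 2 + - a by field.
  rewrite powRD; last by apply/implyP => _; rewrite gt_eqF.
  rewrite mulrA ler_wpM2r ?powR_ge0//.
  have p0 : 0 < t `^ (a / 2) by rewrite powR_gt0.
  have := ln_sublinear p0; rewrite ln_powR => h.
  have -> : ln t = 2 / a * (a / 2 * ln t) by field; rewrite gt_eqF.
  by rewrite ler_pM2l ?divr_gt0// ltW.
- exact: cvg_cst.
- rewrite -[X in _ --> X](mulr0 (2 / a)); apply: cvgMl_tmp.
  by apply: powRN_cvg0; rewrite oppr_lt0 divr_gt0.
Unshelve. all: by end_near. Qed.

Lemma PhiG_small_equiv (T : Type) (F : set_system T) {FF : Filter F} (rho : T -> R) :
  (\forall s \near F, 0 < rho s) -> rho s @[s --> F] --> (0 : R) ->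
  PhiG (rho s) / (rho s ^+ 2 / 4) @[s --> F] --> (1 : R).
Proof.
move=> r0 rho0.
apply: (@squeeze_cvgr _ _ _ _ (fun s => 1 - rho s ^+ 2 / 4) (fun=> 1)).
- near=> s; have s0 : 0 < rho s by near: s.
  have s0' := lt0r_neq0 s0.
  have q0 : 0 < rho s ^+ 2 / 4 by rewrite divr_gt0 ?exprn_gt0.
  rewrite ler_pdivlMr// ler_pdivrMr// mul1r [_ * (_ / _)]mulrC PhiG_ge_small//=.
  by rewrite ltW ?PhiG_lt.
- rewrite -[X in _ --> X]subr0; apply: cvgB; first exact: cvg_cst.
  rewrite -(mul0r (4^-1 : R)) -(mul0r (0 : R)).
  by apply: cvgMr_tmp; apply: cvgM.
- exact: cvg_cst.
Unshelve. all: by end_near. Qed.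

Lemma ln_cvgy (T : Type) (F : set_system T) {FF : Filter F} (f : T -> R) :
  f s @[s --> F] --> +oo -> ln (f s) @[s --> F] --> +oo.
Proof.
move=> /cvgryPge fy; apply/cvgryPge => A; near=> s.
have fA : expR A <= f s by near: s; exact: fy.
by rewrite -[leLHS]expRK ler_ln ?posrE ?expR_gt0// (lt_le_trans (expR_gt0 A)).
Unshelve. all: by end_near. Qed.

Lemma cvgy_inv0 (T : Type) (F : set_system T) {FF : Filter F} (f : T -> R) :
  f s @[s --> F] --> +oo -> (f s)^-1 @[s --> F] --> (0 : R).
Proof.
move=> fy; apply/(gtr0_cvgV0 (f := f)) => //.
by move/cvgryPgt: fy => /(_ 0).
Qed.

Lemma PhiG_large_equiv (T : Type) (F : set_system T) {FF : Filter F} (rho : T -> R) :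
  rho s @[s --> F] --> +oo ->
  PhiG (rho s) / (rho s * Num.sqrt (ln (rho s))) @[s --> F] --> (1 : R).
Proof.
move=> rhoy; have ly : ln (rho s) @[s --> F] --> +oo by exact: ln_cvgy.
have lyA A : \forall s \near F, A <= ln (rho s).
  by move: A; apply/cvgryPge.
have ryA A : \forall s \near F, A <= rho s by move: A; apply/cvgryPge.
have sy : Num.sqrt (ln (rho s)) @[s --> F] --> +oo.
  apply/cvgryPge => A; near=> s.
  have lA : (Num.max A 0) ^+ 2 <= ln (rho s).
    by near: s; exact: lyA.
  apply: (@le_trans _ _ (Num.max A 0)); first by rewrite le_max lexx.
  by rewrite -[leLHS]ger0_norm ?le_max ?lexx ?orbT// -sqrtr_sqr ler_wsqrtr.
apply: (@squeeze_cvgr _ _ _ _ (fun s => 1 - (Num.sqrt (ln (rho s)))^-1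
   - 3 / 2 * (ln (rho s))^-1) (fun=> 1)).
- near=> s; apply: PhiG_large.
  by near: s; exact: ryA.
- rewrite -[X in _ --> X]subr0; apply: cvgB.
    rewrite -[X in _ --> X]subr0; apply: cvgB; first exact: cvg_cst.
    exact: cvgy_inv0.
  by rewrite -[X in _ --> X](mulr0 (3 / 2)); apply: cvgMl_tmp; exact: cvgy_inv0.
- exact: cvg_cst.
Unshelve. all: by end_near. Qed.

(** The common mechanism of all the regimes beyond the diffusive one: [v_ub] and
    [v_lb] squeeze [ln v] as soon as the logarithmic error is negligible with
    respect to the normalisation [N]. *)
Lemma ln_v_equiv (d : nat) (x : R -> d.-tuple R) (N : R -> R) (l : R) :
  (\forall t \near +oo, 0 < enorm (x t)) -> (\forall t \near +oo, 0 < N t) ->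
  t * PhiG (enorm (x t) / t) / N t @[t --> +oo] --> l ->
  (1 + ln (t * xi (enorm (x t) / t))) / N t @[t --> +oo] --> (0 : R) ->
  ln (v (x t) t) / N t @[t --> +oo] --> - l.
Proof.
move=> x0 N0 hl h0; have [C C0 vlb] := v_lb R d.
apply: (@squeeze_cvgr _ _ _ _
  (fun t => - (t * PhiG (enorm (x t) / t) / N t)
     - C * ((1 + ln (t * xi (enorm (x t) / t))) / N t))
  (fun t => - (t * PhiG (enorm (x t) / t) / N t))).
- near=> t; have t1 : 1 <= t by [].
  have xt0 : 0 < enorm (x t) by near: t.
  have Nt0 : 0 < N t by near: t.
  have lo := vlb _ _ t1 xt0; have up := v_ub (lt_le_trans ltr01 t1) xt0.
  have v0 : 0 < v (x t) t by apply: lt_le_trans lo; exact: expR_gt0.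
  rewrite mulrA -mulNr -mulrBl !ler_pM2r ?invr_gt0// -opprD.
  rewrite -[X in X <= _ <= _]expRK -[X in _ <= _ <= X]expRK.
  by rewrite !ler_ln ?posrE ?expR_gt0// lo.
- rewrite -[X in _ --> X]subr0; apply: cvgB; first exact: cvgN.
  by rewrite -[X in _ --> X](mulr0 C); apply: cvgMl_tmp.
- exact: cvgN.
Unshelve. all: by end_near. Qed.

Lemma ln_txi_small (t rho : R) : 0 < t -> 0 < rho <= 2 -> ln (t * xi rho) <= 1 + ln t.
Proof.
move=> t0 /andP[r0 r2]; have r0' := lt0r_neq0 r0; have [z0 _] := xi_exists r0'.
rewrite lnM ?posrE// addrC lerD2r -[leRHS]expRK ler_ln ?posrE ?expR_gt0//.
by apply: le_trans (xi_le_expR r0') _; rewrite ler_expR; nra.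
Qed.

End asymptotics.

(** * The regimes of propagation *)

Section regimes.
Variables (R : realType) (d : nat).
Implicit Types (x : R -> d.-tuple R) (r delta : R).

Lemma v_diffusive r x : 0 < r ->
  (\forall t \near +oo, enorm (x t) <= r * t `^ (1 / 2)) ->
  exists2 e : R -> R, e =o_ (pinfty_nbhs R) (fun t => t `^ (- (1 / 4))) &
    \forall t \near +oo, v (x t) t = heat (x t) t * (1 + e t).
Proof.
move=> r0 xr; have [K K0 vK] := v_over_heat d (ltW r0).
exists (fun t => v (x t) t / heat (x t) t - 1); last first.
  near=> t; have t0 : 0 < t by [].
  by rewrite addrC subrK mulrC divfK// gt_eqF ?heat_gt0.
apply/eqoP => eps eps0.
have c0 : t `^ (- (1 / 4)) @[t --> +oo] --> (0 : R) by apply: powRN_cvg0; lra.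
have ek : 0 < eps / (K + 1) by rewrite divr_gt0//; lra.
near=> t; have t1 : 1 <= t by [].
have t0 : 0 < t by lra.
have sE : Num.sqrt t = t `^ (1 / 2) by rewrite div1r powR12_sqrt ?ltW.
have xt : enorm (x t) <= r * Num.sqrt t by rewrite sE; near: t.
apply: le_trans (vK _ _ t1 xt) _; rewrite [leRHS](_ : _ = eps * t `^ (- (1 / 4))); last first.
  by rewrite ger0_norm ?powR_ge0.
rewrite sE -powRN (_ : - (1 / 2) = - (1 / 4) + - (1 / 4)); last by field.
rewrite powRD; last by apply/implyP => _; rewrite gt_eqF.
rewrite mulrA ler_wpM2r ?powR_ge0//.
have h : t `^ (- (1 / 4)) <= eps / (K + 1).
  by near: t; apply: (cvgr_le _ c0).
move: h; rewrite ler_pdivlMr; last lra.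
have := powR_ge0 t (- (1 / 4)); nra.
Unshelve. all: by end_near. Qed.

Lemma v_moderate r delta x : 0 < r -> 0 < delta < 1 ->
  (\forall t \near +oo, enorm (x t) = r * t `^ ((1 + delta) / 2)) ->
  ln (v (x t) t) / (enorm (x t) ^+ 2 / (4 * t)) @[t --> +oo] --> (-1 : R).
Proof.
move=> r0 /andP[d0 d1] xr.
have rhoE : \forall t \near +oo, enorm (x t) / t = r * t `^ ((delta - 1) / 2).
  near=> t; have t0 : 0 < t by [].
  rewrite (_ : enorm (x t) = r * t `^ ((1 + delta) / 2)); last by near: t.
  rewrite -mulrA -[X in _ / X](powRr1 (ltW t0)) -powRB; last first.
    by apply/implyP => _; rewrite gt_eqF.
  by congr (_ * _ `^ _); field.
have c0 : r * t `^ ((delta - 1) / 2) @[t --> +oo] --> (0 : R).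
  by rewrite -[X in _ --> X](mulr0 r); apply: cvgMl_tmp; apply: powRN_cvg0; lra.
have rho0 : enorm (x t) / t @[t --> +oo] --> (0 : R).
  by apply: cvg_trans c0; apply: near_eq_cvg; near do apply/esym.
have rhop : \forall t \near +oo, 0 < enorm (x t) / t.
  near=> t; rewrite (_ : _ / _ = r * t `^ ((delta - 1) / 2)); last by near: t.
  by rewrite mulr_gt0// powR_gt0.
have xp : \forall t \near +oo, 0 < enorm (x t).
  near=> t; rewrite (_ : enorm (x t) = r * t `^ ((1 + delta) / 2)); last by near: t.
  by rewrite mulr_gt0// powR_gt0.
apply: ln_v_equiv => //.
- near=> t; rewrite divr_gt0 ?exprn_gt0 ?mulr_gt0//; by near: t.
- apply: cvg_trans (PhiG_small_equiv rhop rho0); apply: near_eq_cvg.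
  near=> t; have t0 : 0 < t by [].
  have x0 : 0 < enorm (x t) by near: t.
  by field; rewrite !gt_eqF.
- apply: (@squeeze_cvgr _ _ _ _ (fun=> 0)
    (fun t => 4 / r ^+ 2 * ((2 + ln t) / t `^ delta))).
  + near=> t; have t1 : 1 <= t by [].
    have t0 : 0 < t by lra.
    have x0 : 0 < enorm (x t) by near: t.
    have q0 : 0 < enorm (x t) / t by near: t.
    have q2 : enorm (x t) / t <= 2.
      by near: t; apply: (cvgr_le _ rho0).
    have NE : enorm (x t) ^+ 2 / (4 * t) = r ^+ 2 / 4 * t `^ delta.
      rewrite (_ : enorm (x t) = r * t `^ ((1 + delta) / 2)); last by near: t.
      rewrite exprMn -[(_ `^ _) ^+ 2]powR_mulrn ?powR_ge0// -powRrM divfK//.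
      rewrite powRD; last by apply/implyP => _; rewrite gt_eqF.
      by rewrite powRr1 ?ltW//; field; rewrite gt_eqF.
    have x1 := xi_gt1 (lt0r_neq0 q0).
    rewrite NE divr_ge0 /=; last first.
    * by rewrite mulr_ge0 ?powR_ge0// divr_ge0 ?sqr_ge0.
    * by rewrite addr_ge0// ln_ge0//; nra.
    have -> : 4 / r ^+ 2 * ((2 + ln t) / t `^ delta) =
        (2 + ln t) / (r ^+ 2 / 4 * t `^ delta).
      by field; rewrite !gt_eqF// powR_gt0.
    rewrite ler_pM2r ?invr_gt0 ?mulr_gt0 ?powR_gt0 ?divr_gt0 ?exprn_gt0//.
    have := @ln_txi_small R t (enorm (x t) / t) t0; rewrite q0 q2 => /(_ isT).
    by lra.
  + exact: cvg_cst.
  + rewrite -[X in _ --> X](mulr0 (4 / r ^+ 2)); apply: cvgMl_tmp.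
    exact: ln_powR_cvg0.
Unshelve. all: by end_near. Qed.

(** Here [|x| / t] tends to 0 without being a function of [t] alone, so the bounds
    [v_ub] and [v_lb] are used directly, with
    [r^2 / 4 (1 - r^2 / 4) <= PhiG r <= r^2 / 4]; the upper bound on [|x|] makes
    the correction [1 - r^2 / 4] uniform. *)
Lemma v_moderate_bounds r1 r2 delta x : 0 < r1 -> r1 < r2 -> 0 < delta < 1 ->
  (\forall t \near +oo, r1 * t `^ ((1 + delta) / 2) <= enorm (x t)
                        <= r2 * t `^ ((1 + delta) / 2)) ->
  exists e1 e2 : R -> R,
    [/\ e1 t @[t --> +oo] --> (0 : R), e2 t @[t --> +oo] --> (0 : R) &
      \forall t \near +oo,
        expR (- (r2 ^+ 2 / 4 * t `^ delta * (1 + e2 t))) <= v (x t) t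
        <= expR (- (r1 ^+ 2 / 4 * t `^ delta * (1 + e1 t)))].
Proof.
move=> r10 r12 /andP[d0 d1] xr; have r20 : 0 < r2 by lra.
have [C C0 vlb] := v_lb R d.
exists (fun t => - (r2 ^+ 2 / 4 * t `^ (delta - 1))).
exists (fun t => C * (4 / r2 ^+ 2) * ((2 + ln t) / t `^ delta)).
have c0 : r2 ^+ 2 / 4 * t `^ (delta - 1) @[t --> +oo] --> (0 : R).
  rewrite -[X in _ --> X](mulr0 (r2 ^+ 2 / 4)); apply: cvgMl_tmp.
  by apply: powRN_cvg0; lra.
split.
- by rewrite -[X in _ --> X]oppr0; apply: cvgN.
- rewrite -[X in _ --> X](mulr0 (C * (4 / r2 ^+ 2))); apply: cvgMl_tmp.
  exact: ln_powR_cvg0.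
near=> t; have t1 : 1 <= t by [].
have t0 : 0 < t by lra.
have /andP[xl xu] : r1 * t `^ ((1 + delta) / 2) <= enorm (x t)
    <= r2 * t `^ ((1 + delta) / 2) by near: t.
have small : r2 ^+ 2 / 4 * t `^ (delta - 1) <= 1.
  by near: t; apply: (cvgr_le _ c0).
have x0 : 0 < enorm (x t) by apply: lt_le_trans xl; rewrite mulr_gt0// powR_gt0.
have sqE (r : R) : 0 < r ->
    (r * t `^ ((1 + delta) / 2)) ^+ 2 = r ^+ 2 * (t ^+ 2 * t `^ (delta - 1)).
  move=> r0; rewrite exprMn -[X in _ * X = _](powR_mulrn 2) ?powR_ge0// -powRrM divfK//.
  rewrite -(powR_mulrn 2 (ltW t0)) -powRD; last by apply/implyP => _; rewrite gt_eqF.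
  by congr (_ * _ `^ _); lra.
have tdE : t `^ delta = t * t `^ (delta - 1).
  rewrite -[X in X * _](powRr1 (ltW t0)) -powRD; last by apply/implyP => _; rewrite gt_eqF.
  by congr (_ `^ _); lra.
set q := enorm (x t) / t; have q0 : 0 < q by rewrite divr_gt0.
have p0 : 0 < t `^ (delta - 1) by rewrite powR_gt0.
have qu : q ^+ 2 <= r2 ^+ 2 * t `^ (delta - 1).
  rewrite /q expr_div_n ler_pdivrMr ?exprn_gt0// -mulrA [t `^ _ * _]mulrC -sqE//.
  by rewrite ler_pXn2r// nnegrE ltW// mulr_gt0// powR_gt0.
have ql : r1 ^+ 2 * t `^ (delta - 1) <= q ^+ 2.
  rewrite /q expr_div_n ler_pdivlMr ?exprn_gt0// -mulrA [t `^ _ * _]mulrC -sqE//.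
  by rewrite ler_pXn2r// nnegrE ltW// mulr_gt0// powR_gt0.
have q2 : q <= 2.
  by rewrite -(ler_pXn2r (n := 2))// ?nnegrE ?(ltW q0)//; lra.
have Pl := PhiG_ge_small (lt0r_neq0 q0); have Pu := PhiG_lt (lt0r_neq0 q0).
apply/andP; split.
  apply: le_trans (vlb _ _ t1 x0); rewrite ler_expR lerN2 -/q.
  have -> : r2 ^+ 2 / 4 * t `^ delta * (1 + C * (4 / r2 ^+ 2) * ((2 + ln t) / t `^ delta)) =
     r2 ^+ 2 / 4 * t `^ delta + C * (2 + ln t).
    by field; rewrite !gt_eqF// powR_gt0.
  apply: lerD; last first.
    rewrite ler_wpM2l//; have := @ln_txi_small R t q t0; rewrite q0 q2 => /(_ isT).
    by lra.
  rewrite tdE mulrCA ler_pM2l//; lra.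
apply: le_trans (v_ub t0 x0) _; rewrite ler_expR lerN2 -/q tdE.
rewrite [leLHS](_ : _ = t * (r1 ^+ 2 / 4 * t `^ (delta - 1) *
  (1 - r2 ^+ 2 / 4 * t `^ (delta - 1)))); last by ring.
rewrite ler_pM2l//; apply: le_trans Pl.
apply: (@le_trans _ _ (q ^+ 2 / 4 * (1 - r2 ^+ 2 / 4 * t `^ (delta - 1)))).
  by rewrite ler_wpM2r//; lra.
by rewrite ler_wpM2l ?divr_ge0 ?sqr_ge0//; lra.
Unshelve. all: by end_near. Qed.

Lemma v_linear r x : 0 < r -> (\forall t \near +oo, enorm (x t) = r * t) ->
  ln (v (x t) t) / t @[t --> +oo] --> - PhiG r.
Proof.
move=> r0 xr; have [z0 _] := xi_exists (lt0r_neq0 r0).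
have rhoE : \forall t \near +oo, enorm (x t) / t = r.
  near=> t; rewrite (_ : enorm (x t) = r * t); last by near: t.
  by rewrite mulfK// gt_eqF.
apply: (@ln_v_equiv R d x id).
- near=> t; rewrite (_ : enorm (x t) = r * t); last by near: t.
  by rewrite mulr_gt0.
- by near=> t.
- apply: (@cvg_trans _ ((fun=> PhiG r) t @[t --> +oo])); last exact: cvg_cst.
  apply: near_eq_cvg; near=> t.
  rewrite (_ : enorm (x t) / t = r); last by near: t.
  by rewrite mulrC mulKf// gt_eqF.
- apply: cvg_trans (@ln_powR_cvg0 R (1 + ln (xi r)) 1 ltr01).
  apply: near_eq_cvg; near=> t; have t0 : 0 < t by [].
  rewrite (_ : enorm (x t) / t = r); last by near: t.
  by rewrite powRr1 ?ltW// lnM ?posrE// addrA addrAC.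
Unshelve. all: by end_near. Qed.

(** As [xi r <= r] for large [r], the logarithmic error is at most of order
    [ln |x|], while the main term is at least [|x|]. *)
Lemma v_superlinear delta x : 1 < delta ->
  (\forall t \near +oo, t `^ ((1 + delta) / 2) < enorm (x t)) ->
  ln (v (x t) t) / (enorm (x t) * Num.sqrt (ln (enorm (x t) / t)))
    @[t --> +oo] --> (-1 : R).
Proof.
move=> d1 xr.
have xp : \forall t \near +oo, 0 < enorm (x t).
  near=> t; apply: le_lt_trans (powR_ge0 t ((1 + delta) / 2)) _; by near: t.
have rhoy : enorm (x t) / t @[t --> +oo] --> +oo.
  apply: ger_cvgy (_ : t `^ ((delta - 1) / 2) @[t --> +oo] --> +oo); last first.
    by apply: powR_cvgy; lra.
  near=> t; have t0 : 0 < t by [].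
  rewrite ler_pdivlMr// -[X in _ * X](powRr1 (ltW t0)) -powRD; last first.
    by apply/implyP => _; rewrite gt_eqF.
  rewrite (_ : _ + 1 = (1 + delta) / 2); last by field.
  by apply/ltW; near: t.
have ryA A : \forall t \near +oo, A <= enorm (x t) / t by move: A; apply/cvgryPge.
have xy : enorm (x t) @[t --> +oo] --> +oo.
  apply: ger_cvgy rhoy; near=> t.
  by rewrite ler_pdivrMr// ler_peMr//; apply/ltW; near: t.
apply: ln_v_equiv => //.
- near=> t; have x0 : 0 < enorm (x t) by near: t.
  have l1 : expR 1 <= enorm (x t) / t by near: t; exact: ryA.
  rewrite mulr_gt0// sqrtr_gt0 ln_gt0//; apply: lt_le_trans l1.
  by rewrite expR_gt1.
- apply: cvg_trans (PhiG_large_equiv rhoy); apply: near_eq_cvg.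
  near=> t; have t0 : 0 < t by [].
  have x0 : 0 < enorm (x t) by near: t.
  have l1 : expR 1 <= enorm (x t) / t by near: t; exact: ryA.
  have s0 : 0 < Num.sqrt (ln (enorm (x t) / t)).
    by rewrite sqrtr_gt0 ln_gt0//; apply: lt_le_trans l1; rewrite expR_gt1.
  by field; rewrite !gt_eqF.
- have x3 : (1 + ln (enorm (x t))) / enorm (x t) `^ 1 @[t --> +oo] --> (0 : R).
    exact: (cvg_comp _ _ xy (@ln_powR_cvg0 R 1 1 ltr01)).
  apply: (@squeeze_cvgr _ _ _ _ (fun=> 0)
    (fun t => (1 + ln (enorm (x t))) / enorm (x t) `^ 1)) => //; last exact: cvg_cst.
  near=> t; have t1 : 1 <= t by [].
  have t0 : 0 < t by lra.
  have x0 : 0 < enorm (x t) by near: t.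
  have l1 : 2 * expR 1 <= enorm (x t) / t by near: t; exact: ryA.
  set q := enorm (x t) / t in l1 *; have e0 := expR_gt0 (1 : R).
  have q0 : 0 < q by rewrite divr_gt0.
  have [z0 _] := xi_exists (lt0r_neq0 q0).
  have z1 := xi_gt1 (lt0r_neq0 q0); have zq := xi_le l1.
  have s1 : 1 <= Num.sqrt (ln q).
    rewrite -sqrtr1 ler_wsqrtr// -[leLHS]expRK ler_ln ?posrE//; lra.
  have le0 : 0 <= ln (t * xi q) by rewrite ln_ge0//; nra.
  have le1 : ln (t * xi q) <= ln (enorm (x t)).
    rewrite ler_ln ?posrE ?mulr_gt0//.
    have -> : enorm (x t) = t * q by rewrite /q mulrC divfK// gt_eqF.
    by rewrite ler_pM2l.
  rewrite /= powRr1 ?(ltW x0)// invfM mulrA.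
  rewrite divr_ge0 ?mulr_ge0 ?invr_ge0 ?addr_ge0 ?sqrtr_ge0// ?(ltW x0)//=.
  have ix : 0 < (enorm (x t))^-1 by rewrite invr_gt0.
  rewrite ler_pdivrMr; last lra.
  apply: (@le_trans _ _ ((1 + ln (enorm (x t))) / enorm (x t))).
    by rewrite ler_pM2r// lerD2l.
  by rewrite ler_peMr// mulr_ge0// ?invr_ge0 ?(ltW x0)//; lra.
Unshelve. all: by end_near. Qed.

End regimes.

Lemma PhiG_at_0 (R : realType) :
  exists2 e : R -> R, e r @[r --> 0^'+] --> (0 : R) &
    \forall r \near 0^'+, PhiG r = r ^+ 2 / 4 * (1 + e r).
Proof.
exists (fun r => PhiG r / (r ^+ 2 / 4) - 1).
  rewrite -[X in _ --> X](subrr (1 : R)); apply: cvgB; last exact: cvg_cst.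
  apply: (@PhiG_small_equiv R _ _ _ id); first exact: nbhs_right_gt.
  by apply: cvg_at_right_filter; exact: cvg_id.
near=> r; have r0 : 0 < r by [].
by rewrite [1 + _]addrC subrK mulrC divfK// gt_eqF// divr_gt0 ?exprn_gt0.
Unshelve. all: by end_near. Qed.

Lemma PhiG_at_y (R : realType) :
  exists2 e : R -> R, e r @[r --> +oo] --> (0 : R) &
    \forall r \near +oo, PhiG r = r * Num.sqrt (ln r) * (1 + e r).
Proof.
exists (fun r => PhiG r / (r * Num.sqrt (ln r)) - 1).
  rewrite -[X in _ --> X](subrr (1 : R)); apply: cvgB; last exact: cvg_cst.
  by apply: (@PhiG_large_equiv R _ _ _ id); exact: cvg_id.
near=> r; have r1 : 1 < r by [].
rewrite [1 + _]addrC subrK mulrC divfK// gt_eqF// mulr_gt0 ?sqrtr_gt0 ?ln_gt0//.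
Unshelve. all: by end_near. Qed.

Theorem theorem2p1 (R : realType) (d : nat) (hd : (1 <= d)%N) :
  [/\
    (* 1) *)
    forall (r : R) (x : R -> d.-tuple R), 0 < r ->
      (\forall t \near +oo, enorm (x t) <= r * t `^ (1 / 2)) ->
      exists2 e : R -> R, e =o_ (pinfty_nbhs R) (fun t => t `^ (- (1 / 4))) &
        \forall t \near +oo,
          v (x t) t = ((4 * pi * t) `^ (d%:R / 2))^-1
                      * expR (- (enorm (x t) ^+ 2 / (4 * t))) * (1 + e t),
    (* 2) *)
    (forall (r delta : R) (x : R -> d.-tuple R), 0 < r -> 0 < delta < 1 ->
      (\forall t \near +oo, enorm (x t) = r * t `^ ((1 + delta) / 2)) ->
      ln (v (x t) t) / (enorm (x t) ^+ 2 / (4 * t)) @[t --> +oo] --> (-1 : R)) /\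
    (forall (r1 r2 delta : R) (x : R -> d.-tuple R),
      0 < r1 -> r1 < r2 -> 0 < delta < 1 ->
      (\forall t \near +oo, r1 * t `^ ((1 + delta) / 2) <= enorm (x t)
                            <= r2 * t `^ ((1 + delta) / 2)) ->
      exists e1 e2 : R -> R,
        [/\ e1 t @[t --> +oo] --> (0 : R), e2 t @[t --> +oo] --> (0 : R) &
          \forall t \near +oo,
            expR (- (r2 ^+ 2 / 4 * t `^ delta * (1 + e2 t))) <= v (x t) t
            <= expR (- (r1 ^+ 2 / 4 * t `^ delta * (1 + e1 t)))]),
    (* 3) *)
    [/\ forall (r : R) (x : R -> d.-tuple R), 0 < r ->
          (\forall t \near +oo, enorm (x t) = r * t) ->
          ln (v (x t) t) / t @[t --> +oo] --> - PhiG r,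
        forall r : R, r != 0 -> 0 < PhiG r < r ^+ 2 / 4,
        exists2 e : R -> R, e r @[r --> 0^'+] --> (0 : R) &
          \forall r \near 0^'+, PhiG r = r ^+ 2 / 4 * (1 + e r) &
        exists2 e : R -> R, e r @[r --> +oo] --> (0 : R) &
          \forall r \near +oo, PhiG r = r * Num.sqrt (ln r) * (1 + e r)] &
    (* 4) *)
    forall (delta : R) (x : R -> d.-tuple R), 1 < delta ->
      (\forall t \near +oo, t `^ ((1 + delta) / 2) < enorm (x t)) ->
      ln (v (x t) t) / (enorm (x t) * Num.sqrt (ln (enorm (x t) / t)))
        @[t --> +oo] --> (-1 : R)].
Proof.
split.
- exact: v_diffusive.
- by split; [exact: v_moderate|exact: v_moderate_bounds].
- split; [exact: v_linear| |exact: PhiG_at_0|exact: PhiG_at_y].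
  by move=> r r0; rewrite PhiG_gt0// PhiG_lt.
- exact: v_superlinear.
Qed.
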